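(* Let $n>1$ and let $f$ be drawn uniformly at random from $\mathcal{R}_n$, or (for even $n$) from $\mathcal{N}_n$. Then \[ \mathbb{E}\big(\|f\|_4^4\big)=3n^2-3n+\frac{1-(-1)^n}{2}, \] and ${\rm Var}\big(\|f\|_4^4\big)$ equals \[ 32n^3-216n^2+304n+256\left\lfloor\frac{n}{6}\right\rfloor+256\cdot I[n \bmod 6=4]\quad\text{for } n \text{ even}, \] \[ 32n^3-144n^2+160n-576\left\lfloor\frac{n-1}{4}\right\rfloor-512\left\lfloor\frac{n-1}{6}\right\rfloor-48\quad\text{for } n \text{ odd}. \]
   Context: For a polynomial $f\in\mathbb{C}[z]$ and real $p>0$, $\|f\|_p=\big(\frac{1}{2\pi}\int_0^{2\pi}|f(e^{i\theta})|^p\,d\theta\big)^{1/p}$. For an integer $n>1$, $\mathcal{L}_n$ is the set of polynomials $\sum_{j=0}^{n-1}a_jz^j$ with all $a_j\in\{1,-1\}$. The reciprocal Littlewood polynomials are $\mathcal{R}_n=\{f\in\mathcal{L}_n: f(z)=z^{n-1}f(z^{-1})\}$, and the negative reciprocal Littlewood polynomials are $\mathcal{N}_n=\{f\in\mathcal{L}_n: n\text{ even and } f(z)=-z^{n-1}f(z^{-1})\}$. $I[X]$ denotes the indicator function of the event $X$. *)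

(* Defs.v *)
From mathcomp Require Import all_boot all_order all_algebra.
From mathcomp Require Import finmap complex.
From mathcomp Require Import all_classical all_reals all_analysis.

Set Implicit Arguments.
Unset Strict Implicit.
Unset Printing Implicit Defensive.

Import Order.TTheory GRing.Theory Num.Theory.
Import numFieldNormedType.Exports.

Local Open Scope classical_set_scope.
Local Open Scope complex_scope.
Local Open Scope ring_scope.

Definition expi {R : realType} (theta : R) : R[i] := cos theta +i* sin theta.

Definition circle_norm {R : realType} (p : R) (f : {poly R[i]}) : R :=
  ((2 * pi)^-1 *
    Rintegral lebesgue_measure `[0, 2 * pi]
      (fun theta : R => Normc.normc f.[expi theta] `^ p)) `^ p^-1.

Definition littlewood (R : realType) (n : nat) : set {poly R[i]} :=
  [set f | exists a : nat -> R[i],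
     (forall j, (j < n)%N -> a j = 1 \/ a j = -1) /\ f = \poly_(j < n) a j].
Arguments littlewood : clear implicits.

(* The identities between the Laurent polynomials f(z) and z^(n-1) f(1/z) are
   read pointwise on the nonzero complex numbers. *)
Definition reciprocal_littlewood (R : realType) (n : nat) : set {poly R[i]} :=
  [set f | littlewood R n f /\
     forall z : R[i], z != 0 -> f.[z] = z ^+ n.-1 * f.[z^-1]].
Arguments reciprocal_littlewood : clear implicits.

Definition neg_reciprocal_littlewood (R : realType) (n : nat) :
    set {poly R[i]} :=
  [set f | [/\ littlewood R n f, ~~ odd n &
     forall z : R[i], z != 0 -> f.[z] = - (z ^+ n.-1 * f.[z^-1])]].
Arguments neg_reciprocal_littlewood : clear implicits.

(* No sigma-algebra on the codomain is needed: as A is finite, measurability of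
   the point fibres makes every preimage under F measurable. *)
Definition drawn_uniformly {d : measure_display} {T : measurableType d}
    {R : realType} (P : probability T R) {U : choiceType} (A : set U)
    (F : T -> U) : Prop :=
  [/\ finite_set A,
      forall w, A (F w) &
      forall u, A u -> measurable (F @^-1` [set u]) /\
        P (F @^-1` [set u]) = ((#|` fset_set A|%fset%:R)^-1)%:E].

(* Main.v *)
(* Write h = n - 1. On the unit circle f(1/z) is the conjugate of f(z), so the
   symmetry of f gives |f|^4 = z^(-2h) f^4 and ||f||_4^4 is the coefficient of
   z^(2h) in f^4. Since f(z) -> f(-z) maps N_n onto R_n without changing this
   coefficient, it suffices to treat R_n, where f = sum_p b_p e_p with
   independent signs b_p (p <= h/2) and e_p = z^p + z^(h-p) (e_p = z^p if 2p = h).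

   Expand the coefficient of z^(2h) in f^4 as sum_T c_T prod_(p in T) b_p; the
   mean is c_0 and the variance is the sum of c_T^2 over nonempty T. Only
   |T| <= 4 matters, and for |T| = 4 one has c_T = 0 or 48: up to sign at most
   one signed sum of four distinct |h - 2p| vanishes. So c_T^2 = 48 c_T there,
   and the variance is 48 (sum_T c_T - c_0) + sum_(|T| = 2) c_T (c_T - 48), where
   sum_T c_T = n (2n^2 + 1) / 3 is the value at f = 1 + z + ... + z^h. On pairs
   c_T is 0, 24 or 48, with an extra -16 when 3(h - 2q) = h - 2p; this exception
   and the fixed point 2p = h produce the floor functions. *)
Require Import Defs.
From mathcomp Require Import all_boot all_order all_algebra.
From mathcomp Require Import zify ring.

Import Order.TTheory GRing.Theory Num.Theory.

Local Open Scope ring_scope.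

(** * Walsh expansion of a fourth power *)

(** The symmetric difference with [{y}]. As [b y ^+ 2 = 1], multiplying the character
    [\prod_(i in T) b i] by [b y] gives the character of [toggle y T]. *)
Definition toggle {I : finType} (y : I) (T : {set I}) : {set I} :=
  if y \in T then T :\ y else y |: T.

Lemma toggleK (I : finType) (y : I) : involutive (toggle y).
Proof.
move=> T; rewrite /toggle; case: (boolP (y \in T)) => yT.
  by rewrite setD11 setD1K.
by rewrite setU11 setU1K.
Qed.

Lemma prod_toggle (I : finType) (A : comNzRingType) (b : I -> A) y T :
  b y ^+ 2 = 1 -> b y * \prod_(i in toggle y T) b i = \prod_(i in T) b i.
Proof.
move=> b2; rewrite /toggle; case: ifPn => yT; first by rewrite -big_setD1.
by rewrite big_setU1 //= mulrA -expr2 b2 mul1r.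
Qed.

(** For each fixed [y], the sum over [T] is reindexed by the involution [toggle y]. *)
Lemma walsh_mul (I : finType) (A : comNzRingType) (b e : I -> A)
    (C : {set I} -> A) :
  (forall i, b i ^+ 2 = 1) ->
  (\sum_y b y * e y) * (\sum_(T : {set I}) (\prod_(i in T) b i) * C T) =
  \sum_(T : {set I}) (\prod_(i in T) b i) * \sum_y e y * C (toggle y T).
Proof.
move=> b2; rewrite big_distrl /=.
transitivity (\sum_y \sum_(T : {set I}) (\prod_(i in T) b i) * (e y * C (toggle y T))).
  apply: eq_bigr => y _; rewrite big_distrr /=.
  rewrite (reindex_inj (inv_inj (toggleK I y))) /=.
  by apply: eq_bigr => T _; rewrite -(prod_toggle _ _ b y T) //; ring.
by rewrite exchange_big /=; apply: eq_bigr => T _; rewrite big_distrr.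
Qed.

(** Keeping coefficients in the form [(\prod_(i in T) e i) * D T] lets multiplication by the signed
    sum act on [D] alone: for [y] in [T] the factor [e y] completes the product, for [y] outside it
    leaves [e y ^+ 2]. *)
Lemma walsh_step (I : finType) (A : comNzRingType) (e : I -> A)
    (D : {set I} -> A) (T : {set I}) :
  \sum_y e y * ((\prod_(i in toggle y T) e i) * D (toggle y T)) =
  (\prod_(i in T) e i) *
  (\sum_(y in T) D (T :\ y) + \sum_(y in ~: T) e y ^+ 2 * D (y |: T)).
Proof.
rewrite (bigID (mem T)) /= mulrDr !big_distrr /=; congr (_ + _).
  apply: eq_bigr => y yT; rewrite /toggle yT mulrA.
  by rewrite -big_setD1.
apply: eq_big => y; first by rewrite inE.
move=> yT; rewrite /toggle (negbTE yT) big_setU1 //=.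
by rewrite expr2; ring.
Qed.

(** The coefficient of the character of [T] in the fourth power of [\sum_i b i * e i], with
    [\prod_(i in T) e i] divided out. For two elements, a square from outside [T] has weight 12 and
    one from inside, where an index occurs three times, has weight 4; hence the [8]. *)
Definition quartic_coef {I : finType} {A : comNzRingType} (e : I -> A)
    (T : {set I}) : A :=
  match #|T| with
  | 0 => 3 * (\sum_i e i ^+ 2) ^+ 2 - 2 * \sum_i e i ^+ 4
  | 2 => 12 * \sum_i e i ^+ 2 - 8 * \sum_(i in T) e i ^+ 2
  | 4 => 24
  | _ => 0
  end.

Lemma sum_setC (I : finType) (A : comNzRingType) (F : I -> A) T :
  \sum_(y in ~: T) F y = \sum_y F y - \sum_(y in T) F y.
Proof.
rewrite [in RHS](bigID (mem T)) /= addrAC subrr add0r.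
by apply: eq_bigl => y; rewrite inE.
Qed.

Lemma walsh_quartic (I : finType) (A : comNzRingType) (b e : I -> A) :
  (forall i, b i ^+ 2 = 1) ->
  (\sum_i b i * e i) ^+ 4 =
  \sum_(T : {set I})
    (\prod_(i in T) b i) * ((\prod_(i in T) e i) * quartic_coef e T).
Proof.
move=> b2; set Q := \sum_i e i ^+ 2.
(* [D0] to [D3] play the role of [quartic_coef] for the powers 0 to 3; each is obtained from the
   preceding one by [walsh_step]. *)
pose D0 (T : {set I}) : A := if #|T| is 0 then 1 else 0.
pose D1 (T : {set I}) : A := if #|T| is 1 then 1 else 0.
pose D2 (T : {set I}) : A :=
  match #|T| with 0 => Q | 2 => 2 | _ => 0 end.
pose D3 (T : {set I}) : A :=
  match #|T| with 1 => 3 * Q - 2 * \sum_(i in T) e i ^+ 2 | 3 => 6 | _ => 0 end.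
pose W D := \sum_(T : {set I})
  (\prod_(i in T) b i) * ((\prod_(i in T) e i) * D T).
have step (D D' : {set I} -> A) : (forall T : {set I},
    \sum_(y in T) D (T :\ y) + \sum_(y in ~: T) e y ^+ 2 * D (y |: T) = D' T) ->
    (\sum_i b i * e i) * W D = W D'.
  move=> DD'; rewrite /W walsh_mul //; apply: eq_bigr => T _.
  by rewrite walsh_step DD'.
have cD (T : {set I}) y : y \in T -> #|T :\ y| = #|T|.-1.
  by move=> yT; rewrite (cardsD1 y T) yT.
have cU (T : {set I}) y : y \in ~: T -> #|y |: T| = #|T|.+1.
  by rewrite inE => yT; rewrite cardsU1 yT.
have eqD (F : {set I} -> A) G (T : {set I}) :
    (forall y, y \in T -> #|T :\ y| = #|T|.-1 -> F (T :\ y) = G y) ->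
    \sum_(y in T) F (T :\ y) = \sum_(y in T) G y.
  by move=> H; apply: eq_bigr => y yT; apply: H => //; apply: cD.
have eqU (F : {set I} -> A) G (T : {set I}) :
    (forall y, y \notin T -> #|y |: T| = #|T|.+1 -> F (y |: T) = G y) ->
    \sum_(y in ~: T) e y ^+ 2 * F (y |: T) = \sum_(y in ~: T) e y ^+ 2 * G y.
  move=> H; apply: eq_bigr => y yT; rewrite H ?cU //.
  by move: yT; rewrite inE.
rewrite -/(W (quartic_coef e)) !exprS expr0.
have -> : 1 = W D0.
  rewrite /W (bigD1 set0) //= !big_set0 /D0 cards0 !mul1r big1 ?addr0 //.
  by move=> T; rewrite -cards_eq0; case: #|T| => // k _; rewrite !mulr0.
rewrite (step D0 D1); last first.
  move=> T; rewrite (eqD D0 (fun=> (#|T|==1)%:R)); last first.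
    move=> y yT; rewrite /D0 => ->.
    (* The empty [T] has to be excluded because [#|T|.-1] truncates to 0. *)
    by have: (0 < #|T|)%N by [apply/card_gt0P; exists y]; case: #|T| => [|[|k]].
  rewrite (eqU D0 (fun=> 0)); last by move=> y yT; rewrite /D0 => ->.
  rewrite sumr_const [X in _ + X]big1 => [|y _]; last by rewrite mulr0.
  by rewrite addr0 /D1; case: #|T| => [|[|k]] //=; rewrite mul0rn.
rewrite (step D1 D2); last first.
  move=> T; rewrite (eqD D1 (fun=> (#|T|==2)%:R)); last first.
    move=> y yT; rewrite /D1 => ->.
    by have: (0 < #|T|)%N by [apply/card_gt0P; exists y]; case: #|T| => [|[|[|k]]].
  rewrite (eqU D1 (fun=> (#|T|==0)%:R)); last first.
    by move=> y yT; rewrite /D1 => ->; case: #|T|.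
  rewrite sumr_const -big_distrl /= sum_setC /D2 -/Q.
  case E: #|T| => [|[|[|k]]] //=; rewrite ?mul0rn ?mulr0 ?addr0 //.
  by rewrite (cards0_eq E) big_set0; ring.
rewrite (step D2 D3); last first.
  move=> T; rewrite (eqD D2 (fun=> (#|T|==1)%:R * Q + (#|T|==3)%:R * 2)); last first.
    move=> y yT; rewrite /D2 => ->.
    have: (0 < #|T|)%N by [apply/card_gt0P; exists y].
    by case: #|T| => [|[|[|[|k]]]] //= _; ring.
  rewrite (eqU D2 (fun=> (#|T|==1)%:R * 2)); last first.
    by move=> y yT; rewrite /D2 => ->; case: #|T| => [|[|k]] /=; ring.
  rewrite sumr_const -big_distrl /= sum_setC /D3 -/Q.
  by case E: #|T| => [|[|[|[|k]]]] //=; ring.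
rewrite (step D3 (quartic_coef e)) // => T.
rewrite (eqD D3 (fun y => (#|T| == 2)%:R *
    (3 * Q - 2 * (\sum_(i in T) e i ^+ 2 - e y ^+ 2)) + (#|T| == 4)%:R * 6));
  last first.
  move=> y yT; rewrite /D3 => ->; rewrite [X in _ - 2 * (X - _)](big_setD1 y) //=.
  have: (0 < #|T|)%N by [apply/card_gt0P; exists y].
  by case: #|T| => [|[|[|[|[|k]]]]] //= _; ring.
rewrite (eqU D3 (fun y => (#|T| == 0)%:R * (3 * Q - 2 * e y ^+ 2)
    + (#|T| == 2)%:R * 6)); last first.
  move=> y yT; rewrite /D3 => ->; rewrite big_setU1 //=.
  case E: #|T| => [|[|[|k]]] //=; try ring.
  by rewrite (cards0_eq E) big_set0; ring.
rewrite big_split /= -big_distrr /= sumrB -!mulr_sumr sumrB !sumr_const /quartic_coef -/Q.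
have -> : \sum_(y in ~: T) e y ^+ 2 *
      ((#|T| == 0)%:R * (3 * Q - 2 * e y ^+ 2) + (#|T| == 2)%:R * 6)
  = (#|T| == 0)%:R * (3 * Q * \sum_(y in ~: T) e y ^+ 2
                      - 2 * \sum_(y in ~: T) e y ^+ 4)
    + (#|T| == 2)%:R * 6 * \sum_(y in ~: T) e y ^+ 2.
  rewrite !big_distrr /= -sumrB big_distrr -big_split /=.
  by apply: eq_bigr => y _; ring.
rewrite !sum_setC -/Q.
case E: #|T| => [|[|[|[|[|k]]]]] //=; try ring.
by rewrite (cards0_eq E) !big_set0; ring.
Qed.

(** * Averages over independent signs *)

Lemma sum_sign_prod (I : finType) (A : comNzRingType) (T : {set I}) :
  \sum_(b : {ffun I -> bool}) \prod_(i in T) (-1) ^+ b i =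
  (T == set0)%:R * 2 ^+ #|I| :> A.
Proof.
transitivity (\sum_(b : {ffun I -> bool})
   \prod_i (if i \in T then (-1) ^+ b i else 1 : A)).
  by apply: eq_bigr => b _; rewrite big_mkcond.
rewrite -(bigA_distr_bigA (fun i (j : bool) => if i \in T then (-1) ^+ j else 1 : A)).
case: eqVneq => [->|/set0Pn[i iT]].
  rewrite (eq_bigr (fun=> 2)); first by rewrite prodr_const mul1r.
  by move=> i _; rewrite big_bool !inE.
rewrite (bigD1 i) //= big_bool iT /= expr1 expr0 addNr !mul0r //.
Qed.

Lemma sum_walsh (I : finType) (A : comNzRingType) (c : {set I} -> A) :
  \sum_(b : {ffun I -> bool})
    \sum_(T : {set I}) (\prod_(i in T) (-1) ^+ b i) * c T =
  2 ^+ #|I| * c set0.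
Proof.
rewrite exchange_big /= (bigD1 set0) //= [X in _ + X]big1 ?addr0.
  by rewrite -big_distrl /= sum_sign_prod eqxx mul1r.
by move=> T /negbTE T0; rewrite -big_distrl /= sum_sign_prod T0 !mul0r.
Qed.

(** Parseval's identity: the product of two characters is the character of the symmetric difference,
    whose sum over all signs vanishes unless the two sets coincide. *)
Lemma sum_walsh_sqr (I : finType) (A : comNzRingType) (c : {set I} -> A) :
  \sum_(b : {ffun I -> bool})
    (\sum_(T : {set I}) (\prod_(i in T) (-1) ^+ b i) * c T) ^+ 2 =
  2 ^+ #|I| * \sum_(T : {set I}) c T ^+ 2.
Proof.
pose w (b : {ffun I -> bool}) (T : {set I}) : A := \prod_(i in T) (-1) ^+ b i.
have ww b T U : w b T * w b U = w b ((T :\: U) :|: (U :\: T)).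
  have sq (X : {set I}) : w b X * w b X = 1.
    rewrite /w -big_split /= big1 // => i _.
    by rewrite -exprD addnn -mul2n exprM sqrrN !expr1n.
  have split (X Y : {set I}) : w b X = w b (X :&: Y) * w b (X :\: Y).
    by rewrite /w (big_setID Y).
  have dis : [disjoint T :\: U & U :\: T].
    rewrite -setI_eq0; apply/eqP/setP=> x; rewrite !inE.
    by case: (x \in T); case: (x \in U).
  rewrite (split T U) (split U T) (setIC U T).
  transitivity (w b (T :&: U) * w b (T :&: U) * (w b (T :\: U) * w b (U :\: T))).
    by ring.
  rewrite sq mul1r /w -bigU //; apply: eq_bigl => x.
  by rewrite in_setU.
transitivity (\sum_(b : {ffun I -> bool}) \sum_(T : {set I}) \sum_(U : {set I})
    w b ((T :\: U) :|: (U :\: T)) * (c T * c U)).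
  apply: eq_bigr => b _; rewrite expr2 big_distrlr /=.
  by apply: eq_bigr => T _; apply: eq_bigr => U _; rewrite -ww /w; ring.
rewrite exchange_big /= big_distrr /=; apply: eq_bigr => T _.
rewrite exchange_big /= (bigD1 T) //= [X in _ + X]big1 ?addr0.
  by rewrite -big_distrl /= /w sum_sign_prod setDv setU0 eqxx mul1r -expr2.
move=> U UT; rewrite -big_distrl /= sum_sign_prod.
suff /negbTE-> : (T :\: U) :|: (U :\: T) != set0 by rewrite !mul0r.
apply: contra UT; rewrite setU_eq0 !setD_eq0 => /andP[TU UT].
by rewrite eqEsubset UT TU.
Qed.

(** * Autocorrelation counts *)

Definition orbit_poly (h p : nat) : {poly int} :=
  if (p.*2 == h)%N then 'X^p else 'X^p + 'X^(h - p).

Ltac coef_simp :=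
  rewrite ?expr2 ?(mulrDl, mulrDr) -?exprD ?(coefD, coefXn) ?natz.

Ltac eqn_cases := repeat match goal with
  |- context [(?a == ?b)%N] =>
   first [ rewrite (_ : (a == b)%N = false); last by lia
         | rewrite (_ : (a == b)%N = true); last by lia
         | let E := fresh in case E: (a == b)%N ]
end.

(** With x_i = h - 2i, the exponents in [orbit_poly h i] are (h - x_i)/2 and (h + x_i)/2, so the
    coefficient counts vanishing signed sums of x_p > x_q > x_r > x_s >= 0. Up to a global sign only
    x_p = x_q + x_r + x_s and x_p = x_q + x_r - x_s are possible; both hold only if x_s = 0, and
    then [orbit_poly h s] is a single monomial. *)
Lemma orbit_coef4 (h p q r s : nat) :
  (p < q)%N -> (q < r)%N -> (r < s)%N -> (s.*2 <= h)%N ->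
  (orbit_poly h p * orbit_poly h q * orbit_poly h r * orbit_poly h s)`_(h.*2)
    \in [:: 0; 2].
Proof.
move=> pq qr rs sh; rewrite /orbit_poly.
rewrite (_ : (p.*2 == h) = false); last by lia.
rewrite (_ : (q.*2 == h) = false); last by lia.
rewrite (_ : (r.*2 == h) = false); last by lia.
case: ifPn => s2; coef_simp; set t := (X in X \in _).
- have: t = 0 \/ t = 2; last by case=> ->.
  rewrite /t {t}. eqn_cases; by [left|right].
- have: t = 0 \/ t = 2; last by case=> ->.
  rewrite /t {t}. eqn_cases; by [left|right].
Qed.

(** With x_i = h - 2i, the cross term of the square cannot contribute because x_p > x_q >= 0. What
    remains is 2 x_r = x_p + x_q or 2 x_r = x_p - x_q, each with its mirror image; the two cases
    merge when x_q = 0. *)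
Lemma orbit_coef2 (h p q r : nat) :
  (p < q)%N -> (q.*2 <= h)%N -> (r.*2 <= h)%N ->
  (orbit_poly h p * orbit_poly h q * orbit_poly h r ^+ 2)`_(h.*2) =
  2 * (r.*2 == p + q)%N%:R
  + (if (q.*2 == h)%N then 0 else 2 * (r.*2 + q == h + p)%N%:R).
Proof.
move=> pq qh rh.
rewrite /orbit_poly ifN; last by lia.
case: ifPn => q2; case: ifPn => r2; coef_simp.
- by eqn_cases.
- by eqn_cases.
- by eqn_cases.
- by eqn_cases.
Qed.

(** The first product comes from the ['X^h] terms of both squares; the outer terms of the squares
    pair up to exponent [h.*2] only when [p = q], in two ways. *)
Lemma orbit_coef0 (h p q : nat) :
  (p.*2 <= h)%N -> (q.*2 <= h)%N ->
  (orbit_poly h p ^+ 2 * orbit_poly h q ^+ 2)`_(h.*2) =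
  (2 - (p.*2 == h)%N%:R) * (2 - (q.*2 == h)%N%:R)
  + 2 * ((p == q) && (q.*2 != h))%N%:R.
Proof.
move=> ph qh; rewrite /orbit_poly.
case: ifPn => p2; case: ifPn => q2; coef_simp.
- by rewrite andbF; eqn_cases.
- by eqn_cases.
- by rewrite andbF; eqn_cases.
- by rewrite andbT; eqn_cases.
Qed.

(** * Elementary counts and sums *)

Lemma sum_interval (N a b : nat) :
  (\sum_(i < N) ((a <= i) && (i < b)) = minn N b - a)%N.
Proof. by elim: N => [|N IH]; rewrite ?big_ord0 ?big_ord_recr /= ?IH; lia. Qed.

Lemma sum_ge_triple (N a : nat) : (\sum_(i < N) (a <= 3 * i) = N - (a + 2) %/ 3)%N.
Proof. by elim: N => [|N IH]; rewrite ?big_ord0 ?big_ord_recr /= ?IH; lia. Qed.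

Lemma sum_eq_ord (N a : nat) : (\sum_(i < N) (i == a :> nat) = (a < N))%N.
Proof. by elim: N => [|N IH]; rewrite ?big_ord0 ?big_ord_recr /= ?IH; lia. Qed.

Lemma sum_eq_double (N a : nat) : (a < N.*2)%N ->
  (\sum_(i < N) (i.*2 == a) = ~~ odd a)%N.
Proof.
move=> aN; rewrite (eq_bigr (fun i : 'I_N => ~~ odd a * (i == a./2 :> nat))%N).
  by rewrite -big_distrr /= sum_eq_ord; lia.
by move=> i _; lia.
Qed.

Lemma sum_even_below (q : nat) : (\sum_(p < q) ~~ odd (p + q) = q./2)%N.
Proof.
(* Separating the shift [c] from the bound [q] makes the induction possible. *)
suff H c : (\sum_(p < q) ~~ odd (p + c) = uphalf (q + odd c) - odd c)%N.
  by rewrite H; lia.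
by elim: q => [|N IH]; rewrite ?big_ord0 ?big_ord_recr /= ?IH; lia.
Qed.

Lemma sum_squares (n : nat) : (6 * \sum_(i < n) i.+1 ^ 2 = n * n.+1 * n.*2.+1)%N.
Proof. by elim: n => [|N IH]; rewrite ?big_ord0 // ?big_ord_recr /= mulnDr IH; nia. Qed.

Lemma sum_pair_sets (m : nat) (g : {set 'I_m} -> int) :
  \sum_(T : {set 'I_m} | #|T| == 2) g T =
  \sum_(q < m) \sum_(p < m | (p < q)%N) g [set p; q].
Proof.
rewrite pair_big_dep /= (partition_big
  (fun x : 'I_m * 'I_m => [set x.2; x.1]) (fun T : {set 'I_m} => #|T| == 2)) /=.
  apply: eq_bigr => T /cards2P[x [y [xy ->]]].
  wlog lxy : x y xy / (x < y)%N.
    move=> H; case: (ltngtP x y) => [|yx|/val_inj E]; first exact: H.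
      by rewrite (setUC [set x]); apply: H => //; rewrite eq_sym.
    by rewrite E eqxx in xy.
  rewrite (big_pred1 (y, x)) // => -[q p] /=.
  rewrite xpair_eqE; apply/andP/andP=> [[pq /eqP E]|[/eqP-> /eqP->]] //.
  have: p \in [set x; y] by rewrite -E !inE eqxx.
  have: q \in [set x; y] by rewrite -E !inE eqxx orbT.
  rewrite !inE => /orP[/eqP ?|/eqP ?] /orP[/eqP ?|/eqP ?]; subst;
    by rewrite ?eqxx //; lia.
by move=> [q p] /= pq; rewrite cards2 neq_ltn pq.
Qed.

Lemma geometric_sqr_coef (n k : nat) : (k <= n.-1.*2)%N ->
  ((\poly_(i < n) (1 : int)) ^+ 2)`_k = (minn k.+1 (n.*2.-1 - k))%N.
Proof.
move=> kh; rewrite expr2 coefM.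
rewrite (eq_bigr (fun i : 'I_k.+1 => ((k.+1 - n <= i) && (i < n) : nat)%N%:R)).
  by rewrite -natr_sum sum_interval natz; lia.
move=> i _; rewrite !coef_poly.
have := ltn_ord i; case: ifPn; case: ifPn => *; rewrite ?mulr0 ?mul0r ?mulr1; lia.
Qed.

(** The square has the palindromic coefficients 1, ..., n, ..., 1, so the middle coefficient of its
    square is the sum of their squares. The factor 3 keeps the identity in the integers. *)
Lemma geometric_quartic_coef (n : nat) : (0 < n)%N ->
  3 * ((\poly_(i < n) (1 : int)) ^+ 4)`_(n.-1.*2) = n%:R * (2 * n%:R ^+ 2 + 1).
Proof.
move=> n0; rewrite (exprM _ 2 2) [_ ^+ 2 ^+ 2]expr2 coefM.
pose t i := ((minn i.+1 (n.*2.-1 - i)) ^ 2)%N.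
rewrite (eq_bigr (fun i : 'I_(n.-1.*2).+1 => (t i)%:R)); last first.
  move=> i _; have := ltn_ord i => ih.
  rewrite !geometric_sqr_coef ?leq_subr //.
  by rewrite /t natrX natz expr2; congr (_ * _); lia.
rewrite -natr_sum.
have -> : (\sum_(i < (n.-1.*2).+1) t i = \sum_(i < n) i.+1 ^ 2 + \sum_(i < n.-1) i.+1 ^ 2)%N.
  have -> : ((n.-1.*2).+1 = n + n.-1)%N by lia.
  rewrite big_split_ord /=; congr addn.
    apply: eq_bigr => i _; rewrite /t.
    by congr (_ ^ _)%N; have := ltn_ord i; lia.
  rewrite (reindex_inj rev_ord_inj) /=; apply: eq_bigr => i _; rewrite /t.
  by congr (_ ^ _)%N; have := ltn_ord i; lia.
have := sum_squares n; have := sum_squares n.-1.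
move: (\sum_(i < n) _)%N (\sum_(i < n.-1) _)%N => a b.
case: n n0 {t} => // k _ /= H1 H2; rewrite natz; lia.
Qed.

(** * Moments over the sign cube *)

(** For positive [n], [uphalf n] is the number of orbits of [p -> n.-1 - p] on the exponents below
    [n], each represented by its smaller element. *)
Definition signed_poly (n : nat) (b : {ffun 'I_(uphalf n) -> bool}) : {poly int} :=
  \sum_i (-1) ^+ b i * orbit_poly n.-1 i.

(** The integer that [circle_norm_lift_poly] identifies with the fourth power of the norm. *)
Definition quartic_norm (n : nat) (b : {ffun 'I_(uphalf n) -> bool}) : int :=
  (signed_poly n b ^+ 4)`_(n.-1.*2).

Definition walsh_coef (n : nat) (T : {set 'I_(uphalf n)}) : int :=
  ((\prod_(i in T) orbit_poly n.-1 i)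
   * quartic_coef (fun i : 'I_(uphalf n) => orbit_poly n.-1 i) T)`_(n.-1.*2).

Lemma quartic_norm_walsh n b :
  quartic_norm n b =
  \sum_(T : {set 'I_(uphalf n)}) (\prod_(i in T) (-1) ^+ b i) * walsh_coef n T.
Proof.
rewrite /quartic_norm /signed_poly walsh_quartic; last first.
  by move=> i; rewrite -exprM mulnC exprM sqrrN !expr1n.
rewrite coef_sum; apply: eq_bigr => T _; rewrite /walsh_coef.
have -> : \prod_(i in T) (-1) ^+ b i = (\prod_(i in T) (-1) ^+ b i)%:P :> {poly int}.
  by rewrite rmorph_prod; apply: eq_bigr => i _; rewrite rmorph_sign.
by rewrite coefCM.
Qed.

Lemma double_ord n (i : 'I_(uphalf n)) : (i.*2 <= n.-1)%N.
Proof. by have := ltn_ord i; lia. Qed.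

Lemma sum_middle n : \sum_(i < uphalf n) (i.*2 == n.-1)%:R = (odd n)%:R :> int.
Proof.
case: n => [|n]; first by rewrite big_ord0.
by rewrite -natr_sum sum_eq_double; lia.
Qed.

Lemma walsh_coef_set0 n : (0 < n)%N ->
  walsh_coef n set0 = 3 * n%:R ^+ 2 - 3 * n%:R + (odd n)%:R.
Proof.
move=> n0; rewrite /walsh_coef big_set0 mul1r /quartic_coef cards0.
set m := uphalf n; pose d (i : 'I_m) : int := (i.*2 == n.-1)%:R.
have dd i : d i ^+ 2 = d i by rewrite /d; case: eqP.
have D : \sum_i d i = (odd n)%:R by exact: sum_middle.
(* The orbit sizes [2 - d i] add up to the number [n] of exponents. *)
have M : \sum_(i < m) (2 - d i) = n%:R.
  by rewrite sumrB D sumr_const card_ord /m; lia.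
have c22 (i j : 'I_m) : (orbit_poly n.-1 i ^+ 2 * orbit_poly n.-1 j ^+ 2)`_(n.-1.*2)
    = (2 - d i) * (2 - d j) + 2 * ((i == j)%:R * (1 - d j)).
  rewrite orbit_coef0 ?double_ord // /d -val_eqE.
  by congr (_ + _); case: eqP => //= _; case: eqP.
have c4 (i : 'I_m) : (orbit_poly n.-1 i ^+ 4)`_(n.-1.*2) = 6 - 5 * d i.
  by rewrite (exprD _ 2 2) c22 eqxx; have := dd i; nia.
rewrite coefB !mulr_natl !coefMn !coef_sum.
rewrite (eq_bigr _ (fun i _ => c4 i)) expr2 big_distrlr /= coef_sum.
have -> : \sum_(i < m) (\sum_(j < m) orbit_poly n.-1 i ^+ 2 * orbit_poly n.-1 j ^+ 2)`_(n.-1.*2)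
  = \sum_(i < m) ((2 - d i) * n%:R + 2 * (1 - d i)).
  apply: eq_bigr => i _; rewrite coef_sum (eq_bigr _ (fun j _ => c22 i j)).
  rewrite big_split /= -!mulr_sumr M; congr (_ + 2 * _).
  rewrite (bigD1 i) //= eqxx mul1r big1 ?addr0 // => j.
  by rewrite eq_sym => /negbTE->; rewrite mul0r.
rewrite big_split /= -mulr_suml M -mulr_sumr !sumrB -mulr_sumr D.
rewrite !sumr_const card_ord.
have E : n%:R = 2 *+ m - (odd n)%:R :> int by rewrite /m; lia.
rewrite E -[2 *+ m]mulr_natr -[6 *+ m]mulr_natr.
by ring.
Qed.

(** [orbit_coef2] is summed over all [r]: an index with [r.*2 = p + q] or [r.*2 = n.-1 + p - q]
    exists exactly when the right side is even, giving 12 * 2 = 24 each. Of the corrections at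
    [r = p] and [r = q], only [r = q] with [3 * q = n.-1 + p] contributes, namely - 8 * 2. *)
Lemma walsh_coef_pair n (p q : 'I_(uphalf n)) : (p < q)%N ->
  walsh_coef n [set p; q] =
  24 * (~~ odd (p + q))%:R +
  (if q.*2 == n.-1 then 0
   else 24 * (~~ odd (n.-1 + p + q))%:R - 16 * (3 * q == n.-1 + p)%N%:R).
Proof.
move=> pq; have npq : p != q by rewrite neq_ltn pq.
have npqs : p \notin [set q] by rewrite inE.
have hq := double_ord n q; have hp := double_ord n p.
rewrite /walsh_coef /quartic_coef cards2 npq /= !(big_setU1 _ npqs) !big_set1 /=.
set e := orbit_poly n.-1.
have lin (B C D : {poly int}) k :
    (B * (12 * C - 8 * D))`_k = 12 * (B * C)`_k - 8 * (B * D)`_k.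
  by rewrite mulrBr coefB !(mulrCA B) !mulr_natl !coefMn.
rewrite lin mulr_sumr coef_sum mulrDr coefD !orbit_coef2 //.
rewrite (eq_bigr (fun i : 'I_(uphalf n) => 2 * (i.*2 == p + q)%N%:R
  + (if (q.*2 == n.-1)%N then 0 else 2 * (i.*2 == n.-1 + p - q)%N%:R))); last first.
  move=> i _; rewrite orbit_coef2 ?double_ord //; congr (_ + _).
  by case: ifP => // _; congr (_ * _%:R); lia.
have lq := ltn_ord q.
rewrite big_split /= -mulr_sumr -natr_sum sum_eq_double; last by lia.
case: ifPn => q2.
  rewrite big1 // (_ : (p.*2 == p + q)%N = false); last by lia.
  rewrite (_ : (q.*2 == p + q)%N = false); last by lia.
  by case: odd => /=; lia.
rewrite -mulr_sumr -natr_sum sum_eq_double; last by lia.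
rewrite (_ : (p.*2 == p + q)%N = false); last by lia.
rewrite (_ : (q.*2 == p + q)%N = false); last by lia.
rewrite (_ : (p.*2 + q == n.-1 + p)%N = false); last by lia.
rewrite (_ : (q.*2 + q == n.-1 + p)%N = (3 * q == n.-1 + p)%N); last by lia.
by lia.
Qed.

Lemma walsh_coef_large n (T : {set 'I_(uphalf n)}) : T != set0 -> #|T| != 2 ->
  walsh_coef n T * (walsh_coef n T - 48) = 0.
Proof.
rewrite -cards_eq0 /walsh_coef /quartic_coef.
case E: #|T| => [|[|[|[|[|k]]]]] // _ _; rewrite ?mulr0 ?coef0 ?mul0r //.
(* Listing [T] in increasing order supplies the chain of inequalities for [orbit_coef4], so the
   coefficient is 24 times 0 or 2. *)
have srt : sorted ltn [seq val i | i <- enum T].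
  by apply: (subseq_sorted ltn_trans (s2 := iota 0 (uphalf n)));
    rewrite ?iota_ltn_sorted // -val_enum_ord map_subseq // (enumT 'I__) filter_subseq.
rewrite -big_enum /=.
move: srt; have : size (enum T) = 4 by rewrite -cardE.
case: (enum T) => [|p [|q [|r [|s [|]]]]] //= _ /and4P[pq qr rs _].
rewrite !big_cons big_nil mulr1 mulr_natr coefMn !mulrA.
have := orbit_coef4 n.-1 p q r s pq qr rs (double_ord n s).
by rewrite !inE => /orP[/eqP->|/eqP->].
Qed.

Lemma sum_orbit_poly n : (0 < n)%N ->
  \sum_(i < uphalf n) orbit_poly n.-1 i = \poly_(i < n) 1.
Proof.
move=> n0; apply/polyP => k; rewrite coef_sum coef_poly.
case: ifPn => kn; last first.
  rewrite big1 // => i _; have := double_ord n i => hi; rewrite /orbit_poly.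
  by case: ifPn => _; rewrite ?coefD !coefXn; eqn_cases.
(* Exponent [k] lies in the orbit of [k] or of [n.-1 - k]; the second is discarded at the fixed
   point to avoid counting it twice. *)
rewrite (eq_bigr (fun i : 'I_(uphalf n) =>
    ((i == k :> nat) + ((n.-1 - k).*2 != n.-1) * (i == n.-1 - k :> nat))%N%:R)).
  by rewrite -natr_sum big_split /= -big_distrr /= !sum_eq_ord; lia.
move=> i _; have := double_ord n i => hi; rewrite /orbit_poly.
by case: ifPn => ih; rewrite ?coefD !coefXn -?natrD; congr (_%:R); lia.
Qed.

(** The sum is the Walsh expansion evaluated with all signs equal to 1. *)
Lemma sum_walsh_coef n : (0 < n)%N ->
  3 * \sum_(T : {set 'I_(uphalf n)}) walsh_coef n T = n%:R * (2 * n%:R ^+ 2 + 1).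
Proof.
move=> n0; rewrite -geometric_quartic_coef // -sum_orbit_poly //.
congr (3 * _); have := quartic_norm_walsh n [ffun=> false].
rewrite (eq_bigr (walsh_coef n)) => [<-|T _]; last first.
  by rewrite big1 ?mul1r // => i _; rewrite ffunE expr0.
rewrite /quartic_norm /signed_poly.
apply: (congr1 (fun p : {poly int} => (p ^+ 4)`_(n.-1.*2))).
by apply: eq_bigr => i _; rewrite ffunE expr0 mul1r.
Qed.

(** The map c -> c (c - 48) vanishes at 0 and 48 and is -576 at 24. In the exceptional case
    [3 * q = h + p] the value 24 drops to 8, giving -320 = -576 + 256, and 48 drops to 32, giving
    -512. For even [n] the value before the drop is always 24; for odd [n] it is 0 or 48, except
    when [q] is the fixed point. *)
Lemma sum_pair_defect n : (1 < n)%N ->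
  \sum_(T : {set 'I_(uphalf n)} | #|T| == 2)
     walsh_coef n T * (walsh_coef n T - 48) =
  if ~~ odd n then
    - 72 * n%:R ^+ 2 + 144 * n%:R + 256 * (n %/ 6)%N%:R
      + 256 * (n %% 6 == 4)%N%:R
  else - 576 * ((n - 1) %/ 4)%N%:R - 512 * ((n - 1) %/ 6)%N%:R.
Proof.
move=> n1; set m := uphalf n; set h := n.-1.
rewrite sum_pair_sets.
(* [J q] is the total over all [p < q]. The exceptional [p = 3 * q - h] is nonnegative exactly when
   [h <= 3 * q], and lies below [q] away from the fixed point. *)
pose J (q : nat) : int :=
  if (q.*2 == h)%N then - 576 * (q./2)%:R
  else if ~~ odd n then - 576 * q%:R + 256 * (h <= 3 * q)%N%:R
  else - 512 * (h <= 3 * q)%N%:R.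
transitivity (\sum_(q < m) J q).
  apply: eq_bigr => q _.
  have hq := double_ord n q; have qm := ltn_ord q.
  (* The factor [(h <= 3 * q)] guards against the truncated subtraction [3 * q - h]. *)
  pose G (p : nat) : int :=
    if (q.*2 == h)%N then - 576 * (~~ odd (p + q))%:R
    else if ~~ odd n then - 576 + 256 * (p == 3 * q - h)%N%:R * (h <= 3 * q)%N%:R
    else - 512 * (p == 3 * q - h)%N%:R * (h <= 3 * q)%N%:R.
  transitivity (\sum_(p < m | (p < q)%N) G p).
    apply: eq_bigr => p pq; rewrite walsh_coef_pair // /G -/h.
    have -> : (3 * q == h + p)%N = ((h <= 3 * q) && (p == 3 * q - h :> nat))%N by lia.
    case: (q.*2 =P h) => q2; first by case: odd.
    case nodd: (odd n); case p1: (odd (p + q)); case p2: (odd (h + p + q));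
      case hq3: (h <= 3 * q)%N; case pE: (p == 3 * q - h :> nat)%N => //=; lia.
  rewrite (big_ord_narrow (ltnW qm)) /= /G /J.
  case: ifPn => q2.
    by rewrite -mulr_sumr -natr_sum sum_even_below.
  have E : (h <= 3 * q)%N -> (3 * q - h < q)%N by lia.
  case: ifPn => no.
    rewrite big_split /= sumr_const card_ord -mulr_suml -mulr_sumr -natr_sum sum_eq_ord.
    case: (h <= 3 * q)%N E => [/(_ isT) ->|_]; rewrite ?mulr0 ?mulr1; lia.
  rewrite -mulr_suml -mulr_sumr -natr_sum sum_eq_ord.
  by case: (h <= 3 * q)%N E => [/(_ isT) ->|_]; rewrite ?mulr0 ?mulr1; lia.
have sumq (N : nat) : (\sum_(q < N) q * 2 = N * N.-1)%N.
  by elim: N => [|N IH]; rewrite ?big_ord0 // big_ord_recr /= IH; nia.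
case: ifPn => no.
  rewrite (eq_bigr (fun q : 'I_m => - 576 * (q : nat)%:R + 256 * (h <= 3 * q)%N%:R)).
    rewrite big_split /= -!mulr_sumr -!natr_sum sum_ge_triple.
    have := sumq m; rewrite -big_distrl /=.
    have -> : (m - (h + 2) %/ 3 = n %/ 6 + (n %% 6 == 4))%N by rewrite /m /h; lia.
    have -> : n%:R = m%:R *+ 2 :> int by rewrite /m; lia.
    move: (n %/ 6)%N (nat_of_bool _) m (\sum_(i < m) i)%N => u v k s' E.
    have {}E : s'%:R * 2 = k%:R * (k%:R - 1) :> int by nia.
    have -> : - 576 * s'%:R = - 288 * (s'%:R * 2) :> int by ring.
    by rewrite E natrD; ring.
  have mh : (m.*2 = h.+1)%N by rewrite /m /h; lia.
  by move=> q _; rewrite /J no; have qm := ltn_ord q; rewrite ifN //; lia.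
have mE : m = n./2.+1 by rewrite /m; lia.
have hE : h = n./2.*2 by rewrite /h; lia.
(* For odd [n] the last index [n./2] is the fixed point and is split off. *)
rewrite mE big_ord_recr /=.
rewrite (eq_bigr (fun q : 'I_n./2 => - 512 * (h <= 3 * q)%N%:R)); last first.
  by move=> q _; rewrite /J (negbTE no); have qm := ltn_ord q; rewrite ifN //; lia.
rewrite -mulr_sumr -natr_sum sum_ge_triple /J ifT; last by rewrite /h; lia.
have -> : (n./2 - (h + 2) %/ 3 = (n - 1) %/ 6)%N by rewrite /h; lia.
have -> : (n./2./2 = (n - 1) %/ 4)%N by lia.
by ring.
Qed.

Definition quartic_mean (n : nat) : int := 3 * n%:R ^+ 2 - 3 * n%:R + (odd n)%:R.

Definition quartic_variance (n : nat) : int :=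
  if ~~ odd n then
    32 * n%:R ^+ 3 - 216 * n%:R ^+ 2 + 304 * n%:R
      + 256 * (n %/ 6)%N%:R + 256 * (n %% 6 == 4)%N%:R
  else
    32 * n%:R ^+ 3 - 144 * n%:R ^+ 2 + 160 * n%:R
      - 576 * ((n - 1) %/ 4)%N%:R - 512 * ((n - 1) %/ 6)%N%:R - 48.

Lemma sum_quartic_norm n : (0 < n)%N ->
  \sum_(b : {ffun 'I_(uphalf n) -> bool}) quartic_norm n b =
  2 ^+ uphalf n * quartic_mean n.
Proof.
move=> n0; rewrite (eq_bigr _ (fun b _ => quartic_norm_walsh n b)).
by rewrite sum_walsh card_ord walsh_coef_set0.
Qed.

Lemma sum_quartic_norm_dev n : (1 < n)%N ->
  \sum_(b : {ffun 'I_(uphalf n) -> bool}) (quartic_norm n b - quartic_mean n) ^+ 2 =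
  2 ^+ uphalf n * quartic_variance n.
Proof.
move=> n1; have n0 := ltnW n1; set c := walsh_coef n; set mu := quartic_mean n.
have c0 : c set0 = mu by exact: walsh_coef_set0.
transitivity (2 ^+ uphalf n * (\sum_(T : {set 'I_(uphalf n)}) c T ^+ 2 - mu ^+ 2)).
  transitivity (\sum_(b : {ffun 'I_(uphalf n) -> bool})
     (quartic_norm n b ^+ 2 + (- 2 * mu * quartic_norm n b + mu ^+ 2))).
    by apply: eq_bigr => b _; ring.
  rewrite !big_split /= -mulr_sumr sum_quartic_norm // -/mu.
  rewrite (eq_bigr _ (fun b _ => congr1 (fun x => x ^+ 2) (quartic_norm_walsh n b))).
  rewrite sum_walsh_sqr card_ord sumr_const card_ffun card_bool card_ord.
  by rewrite -(mulr_natl (mu ^+ 2)) natrX; ring.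
congr (_ * _).
have S1 : 3 * \sum_(T : {set 'I_(uphalf n)}) c T = n%:R * (2 * n%:R ^+ 2 + 1).
  exact: sum_walsh_coef.
have S2 := sum_pair_defect n n1.
(* From c^2 = 48 c + c (c - 48): the second term survives only for the empty set and for pairs. The
   48 is split as 16 * 3 to match [S1]. *)
have -> : \sum_(T : {set 'I_(uphalf n)}) c T ^+ 2 =
    16 * (3 * \sum_(T : {set 'I_(uphalf n)}) c T) + (mu * (mu - 48)
     + \sum_(T : {set 'I_(uphalf n)} | #|T| == 2) c T * (c T - 48)).
  transitivity (\sum_(T : {set 'I_(uphalf n)}) (48 * c T + c T * (c T - 48))).
    by apply: eq_bigr => T _; ring.
  rewrite big_split /= -mulr_sumr; congr (_ + _); first by ring.
  rewrite (bigD1 set0) //= c0; congr (_ + _).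
  rewrite (bigID (fun T : {set 'I_(uphalf n)} => #|T| == 2)) /= [X in _ + X]big1 ?addr0.
    by apply: eq_bigl => T; rewrite -cards_eq0; case: #|T| => [|[|[|]]].
  by move=> T /andP[T0 T2]; exact: walsh_coef_large.
rewrite S1 S2 /quartic_variance /mu /quartic_mean.
by case: (odd n) => /=; ring.
Qed.

(** * The fourth norm as a coefficient *)

From mathcomp Require Import finmap complex.
From mathcomp Require Import all_classical all_reals all_analysis.

Import numFieldNormedType.Exports.

Local Open Scope classical_set_scope.
Local Open Scope ring_scope.

Lemma sin_multiple_2pi (R : realType) (n : nat) : sin (n%:R * (2 * pi)) = 0 :> R.
Proof.
have -> : n%:R * (2 * pi) = 0 + (pi *+ 2) *+ n :> R.
  by rewrite add0r -[(pi *+ 2) *+ n]mulr_natl -[pi *+ 2]mulr_natl.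
by rewrite (periodicn (@sinD2pi R)) sin0.
Qed.

Lemma Rintegral_cos_sum (R : realType) (N k : nat) (g : 'I_N -> R) :
  Rintegral lebesgue_measure `[0, 2 * pi]
    (fun t : R => \sum_(i < N) g i * cos ((i%:R - k%:R) * t)) =
  2 * pi * \sum_(i < N) g i * (i == k :> nat)%:R.
Proof.
pose c (i : 'I_N) : R := i%:R - k%:R.
have c0 (i : 'I_N) : (c i == 0) = (i == k :> nat).
  by rewrite /c subr_eq0 eqr_nat.
(* A termwise antiderivative; the sine terms vanish at both ends of the period, so only the zero
   frequency [i = k] survives. *)
pose Fi (i : 'I_N) (t : R) : R :=
  g i * (if i == k :> nat then t else (c i)^-1 * sin (c i * t)).
have dFi (i : 'I_N) (t : R) : is_derive t 1 (Fi i) (g i * cos (c i * t)).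
  rewrite /Fi; case: (eqVneq (i : nat) k) => [ik|ik].
    have -> : c i = 0 by apply/eqP; rewrite c0 ik.
    rewrite mul0r cos0.
    exact: is_deriveZ.
  have ci : c i != 0 by rewrite c0.
  apply: is_deriveZ.
  have -> : cos (c i * t) = (c i)^-1 *: (cos (c i * t) * (c i * 1)).
    by rewrite mulr1 -[_ *: _]/(_ * _) mulrCA mulVf // mulr1.
  by apply: is_deriveZ; apply: is_derive1_comp.
pose F (t : R) : R := \sum_(i < N) Fi i t.
have dF (t : R) : is_derive t 1 F (\sum_(i < N) g i * cos (c i * t)).
  have -> : F = \sum_(i < N) Fi i by apply/funext => u; rewrite /F fct_sumE.
  exact: is_derive_sum.
have pi2 : (0 : R) < 2 * pi by rewrite mulr_gt0 // pi_gt0.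
have cF : continuous F.
  move=> t; apply: differentiable_continuous; apply/derivable1_diffP.
  exact: ex_derive.
have cf : continuous (fun t : R => \sum_(i < N) g i * cos (c i * t)).
  move=> t; apply: cvg_big => [|i _]; first exact: add_continuous.
  apply: continuousM; first exact: cst_continuous.
  apply: continuous_comp; last exact: continuous_cos.
  by apply: continuousM; [exact: cst_continuous|exact: cvg_id].
rewrite /Rintegral (@continuous_FTC2 _ _ F) //.
- rewrite -EFinB /= /F -sumrB mulr_sumr; apply: eq_bigr => i _.
  rewrite /Fi /c; case: (eqVneq (i : nat) k) => ik /=.
    by rewrite mulr0 mulr1 subr0 mulrC.
  rewrite mulrBl sinB !sin_multiple_2pi !mulr0 sin0 !mul0r subrr !mulr0.
  by rewrite subrr.
- exact: continuous_subspaceT.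
- split.
  + by move=> t _; apply: ex_derive.
  + exact/cvg_at_right_filter/cF.
  + exact/cvg_at_left_filter/cF.
- by move=> t _; rewrite derive1E; apply: derive_val.
Qed.

Lemma expiD (R : realType) (s t : R) : expi (s + t) = expi s * expi t.
Proof.
rewrite /expi cosD sinD; apply/eqP; rewrite eq_complex /= eqxx /=.
by apply/eqP; rewrite addrC [sin s * _]mulrC [cos s * sin t]mulrC.
Qed.

Lemma expiX (R : realType) (t : R) n : expi t ^+ n = expi (n%:R * t).
Proof.
elim: n => [|n IH]; first by rewrite mul0r expr0 /expi sin0 cos0.
by rewrite exprS IH -expiD -nat1r mulrDl mul1r.
Qed.

Lemma expiN_mul (R : realType) (t : R) : expi t * expi (- t) = 1.
Proof. by rewrite -expiD subrr /expi sin0 cos0. Qed.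

Lemma expi_neq0 (R : realType) (t : R) : expi t != 0.
Proof.
by apply/eqP => e0; have /eqP := expiN_mul R t; rewrite e0 mul0r eq_sym oner_eq0.
Qed.

Lemma expiV (R : realType) (t : R) : (expi t)^-1 = expi (- t).
Proof. by apply: (mulfI (expi_neq0 R t)); rewrite mulfV ?expi_neq0 // expiN_mul. Qed.

(** On the circle the conjugate of f(z) is f(1/z) = s z^(-h) f(z), hence |f|^4 = s^2 z^(-2h) f^4,
    and taking real parts yields cosines. The summation range is enlarged so that it contains the
    index [h.*2]. *)
Lemma normc_quartic (R : realType) (h : nat) (s : R[i]) (F : {poly int}) (t : R) :
  s ^+ 2 = 1 ->
  (forall z : R[i], z != 0 ->
     (map_poly intr F).[z] = s * (z ^+ h * (map_poly intr F).[z^-1])) ->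
  Normc.normc (map_poly intr F).[expi t] ^+ 4 =
  \sum_(i < size (F ^+ 4) + h.*2.+1)
     ((F ^+ 4)`_i)%:~R * cos ((i%:R - h.*2%:R) * t).
Proof.
move=> s2 Fsym; set f := map_poly intr F; set z := expi t.
have z0 : z != 0 by exact: expi_neq0.
have zc : (z^*)%C = z^-1 by rewrite /z expiV /expi /= cosN sinN.
have fc : (f.[z]^*)%C = s * (z^-1 ^+ h * f.[z]).
  have -> : (f.[z]^*)%C = (map_poly (@conjc R) f).[(z^*)%C] by rewrite horner_map.
  rewrite zc /f -map_poly_comp.
  have -> : map_poly (@conjc R \o intr) F = f.
    by apply: eq_map_poly => x /=; rewrite rmorph_int.
  by have := Fsym z^-1; rewrite invr_eq0 invrK -/f => ->.
have nE : ((Normc.normc f.[z] ^+ 4)%:C)%C = z^-1 ^+ h.*2 * (map_poly intr (F ^+ 4)).[z].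
  rewrite rmorphXn /= (exprM _ 2 2).
  have -> : ((Normc.normc f.[z])%:C)%C ^+ 2 = f.[z] * (f.[z]^*)%C by exact: sqr_normc.
  rewrite fc rmorphXn /= horner_exp -/f -muln2.
  transitivity (s ^+ 2 * (z^-1 ^+ (h * 2) * f.[z] ^+ 4)).
    by rewrite exprM; move: (z^-1 ^+ h) f.[z] => a b; ring.
  by rewrite s2 mul1r.
have -> : Normc.normc f.[z] ^+ 4 = complex.Re ((Normc.normc f.[z] ^+ 4)%:C)%C by [].
rewrite nE (@horner_coef_wide _ (size (F ^+ 4) + h.*2.+1)%N); last first.
  by apply: (leq_trans (size_poly _ _)); rewrite leq_addr.
rewrite mulr_sumr raddf_sum /=; apply: eq_bigr => i _.
rewrite coef_map /= expiV !expiX mulrCA -expiD.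
have -> : ((F ^+ 4)`_i)%:~R = ((((F ^+ 4)`_i)%:~R : R)%:C)%C :> R[i] by rewrite rmorph_int.
by rewrite /expi /= mul0r subr0; congr (_ * cos _); ring.
Qed.

Lemma circle_norm_quartic (R : realType) (h : nat) (s : R[i]) (F : {poly int}) :
  s ^+ 2 = 1 ->
  (forall z : R[i], z != 0 ->
     (map_poly intr F).[z] = s * (z ^+ h * (map_poly intr F).[z^-1])) ->
  circle_norm (4 : R) (map_poly intr F) ^+ 4 = ((F ^+ 4)`_(h.*2))%:~R.
Proof.
move=> s2 Fsym; rewrite /circle_norm.
set I := Rintegral _ _ _.
have IE : I = 2 * pi * ((F ^+ 4)`_(h.*2))%:~R.
  have E (t : R) : Normc.normc (map_poly intr F).[expi t] `^ 4 =
      \sum_(i < size (F ^+ 4) + h.*2.+1)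
        ((F ^+ 4)`_i)%:~R * cos ((i%:R - h.*2%:R) * t).
    rewrite -(@normc_quartic R h s) // powR_mulrn //.
    by case: (_.[_]) => a b; exact: sqrtr_ge0.
  rewrite /I (funext E).
  rewrite Rintegral_cos_sum; congr (_ * _).
  have hN : (h.*2 < size (F ^+ 4) + h.*2.+1)%N by lia.
  rewrite (bigD1 (Ordinal hN)) //= eqxx mulr1 big1 ?addr0 // => i.
  by rewrite -val_eqE /= => /negbTE->; rewrite mulr0.
have pi0 : (0 : R) < 2 * pi by rewrite mulr_gt0 // pi_gt0.
have I0 : 0 <= I by apply: Rintegral_ge0 => t _; exact: powR_ge0.
(* The fourth root and the fourth power cancel because the integral is nonnegative. *)
rewrite -powR_mulrn ?powR_ge0 // -powRrM mulVf ?powRr1 //.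
- by rewrite IE mulrA mulVf ?mul1r // gt_eqF.
- by rewrite mulr_ge0 // invr_ge0 ltW.
Qed.

(** * Parametrization by signs *)

(** In characteristic zero the points 1, ..., [size p] are distinct and nonzero, which is too many
    roots. *)
Lemma poly_eq0_off0 (K : numFieldType) (p : {poly K}) :
  (forall z, z != 0 -> p.[z] = 0) -> p = 0.
Proof.
move=> p0; apply/eqP/negP => /negP pN0.
have := @max_poly_roots _ p [seq k.+1%:R | k <- iota 0 (size p)] pN0.
rewrite size_map size_iota ltnn => H; apply: notF; apply: H.
  by apply/allP => _ /mapP[k _ ->]; rewrite rootE p0 // pnatr_eq0.
by rewrite map_inj_uniq ?iota_uniq // => j k /eqP; rewrite eqr_nat => /eqP[].
Qed.

(** Off 0, z^(n-1) p(1/z) is the value of the polynomial with reversed coefficients, and two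
    polynomials agreeing off 0 are equal. *)
Lemma reciprocal_coefP (K : numFieldType) (n : nat) (s : K) (p : {poly K}) :
  (size p <= n)%N ->
  (forall z, z != 0 -> p.[z] = s * (z ^+ n.-1 * p.[z^-1])) <->
  (forall j, (j < n)%N -> p`_j = s * p`_(n.-1 - j)).
Proof.
move=> pn; pose q := \poly_(j < n) (s * p`_(n.-1 - j)).
have qE z : z != 0 -> q.[z] = s * (z ^+ n.-1 * p.[z^-1]).
  move=> z0; rewrite horner_poly (horner_coef_wide _ pn) mulr_sumr mulr_sumr.
  rewrite (reindex_inj rev_ord_inj) /=; apply: eq_bigr => i _.
  have := ltn_ord i => ni; have -> : (n - i.+1 = n.-1 - i)%N by lia.
  rewrite subKn; last by lia.
  rewrite -mulrA; congr (_ * _); rewrite mulrCA; congr (_ * _).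
  by rewrite exprVn expfB_cond ?(negbTE z0) //; lia.
split=> [H j jn|H z z0].
  have /subr0_eq pq : p - q = 0.
    apply: poly_eq0_off0 => z z0; rewrite hornerD hornerN qE //.
    by rewrite -(H z z0) subrr.
  by rewrite [LHS](congr1 (fun r : {poly K} => r`_j) pq) coef_poly jn.
rewrite -qE //; congr _.[_]; apply/polyP => j; rewrite coef_poly.
by case: ltnP => jn; [exact: H | rewrite nth_default // (leq_trans pn)].
Qed.

Lemma coef_comp_scaleX (A : comNzRingType) (p : {poly A}) c j :
  (p \Po (c *: 'X))`_j = c ^+ j * p`_j.
Proof.
rewrite comp_polyE coef_sum.
have [jp|pj] := ltnP j (size p).
  rewrite (bigD1 (Ordinal jp)) //= exprZn !coefZ coefXn eqxx mulr1 mulrC big1 ?addr0 //.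
  move=> i; rewrite -val_eqE /= exprZn !coefZ coefXn eq_sym => /negbTE->.
  by rewrite !mulr0.
rewrite nth_default // mulr0 big1 // => i _; rewrite exprZn !coefZ coefXn.
by rewrite gtn_eqF ?mulr0 // (leq_trans (ltn_ord i)).
Qed.

Lemma signed_poly_coef n b (i : 'I_(uphalf n)) j : (j < n)%N ->
  i = minn j (n.-1 - j) :> nat -> (signed_poly n b)`_j = (-1) ^+ b i.
Proof.
move=> jn ij; rewrite coef_sum.
have E (k : 'I_(uphalf n)) :
    ((-1) ^+ b k * orbit_poly n.-1 k)`_j = (k == i)%:R * (-1) ^+ b k.
  have -> : (-1) ^+ b k = ((-1) ^+ b k)%:P :> {poly int} by rewrite rmorph_sign.
  rewrite coefCM mulrC; congr (_ * _); rewrite -val_eqE /= ij.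
  have := double_ord n k; rewrite /orbit_poly.
  by case: ifPn => kn hk; rewrite ?coefD !coefXn -?natrD; congr (_%:R); lia.
rewrite (bigD1 i) //= E eqxx mul1r big1 ?addr0 // => k /negbTE ki.
by rewrite E ki mul0r.
Qed.

Lemma size_signed_poly n b : (size (signed_poly n b) <= n)%N.
Proof.
apply: (leq_trans (size_sum _ _ _)); apply/bigmax_leqP => k _.
have -> : (-1) ^+ b k = ((-1) ^+ b k)%:P :> {poly int} by rewrite rmorph_sign.
rewrite mul_polyC; apply: (leq_trans (size_scale_leq _ _)).
have := double_ord n k; have := ltn_ord k; rewrite /orbit_poly => kn hk.
case: ifPn => _; first by rewrite size_polyXn; lia.
by rewrite (leq_trans (size_polyD _ _)) // !size_polyXn; lia.
Qed.

(** The substitution z -> -z for [s = true], which passes from reciprocal to negative reciprocal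
    polynomials when [n] is even. *)
Definition twisted_poly (s : bool) n b : {poly int} :=
  signed_poly n b \Po ((-1) ^+ s *: 'X).

Lemma twisted_poly_coef s n b (i : 'I_(uphalf n)) j : (j < n)%N ->
  i = minn j (n.-1 - j) :> nat ->
  (twisted_poly s n b)`_j = (-1) ^+ (s && odd j) * (-1) ^+ b i.
Proof.
move=> jn ij; rewrite coef_comp_scaleX (signed_poly_coef _ _ _ _ jn ij) -exprM.
by congr (_ * _); case: s; rewrite ?mul1n ?mul0n //= signr_odd.
Qed.

(** The exponent [n.-1.*2] is even, so the substitution z -> -z leaves this coefficient
    unchanged. *)
Lemma twisted_poly_quartic s n b :
  (twisted_poly s n b ^+ 4)`_(n.-1.*2) = quartic_norm n b.
Proof.
rewrite /twisted_poly -rmorphXn coef_comp_scaleX -exprM -signr_odd oddM odd_double.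
by rewrite andbF mul1r.
Qed.

Lemma fold_ord n j : (j < n)%N -> {i : 'I_(uphalf n) | i = minn j (n.-1 - j) :> nat}.
Proof.
move=> jn; have ij : (minn j (n.-1 - j) < uphalf n)%N by lia.
by exists (Ordinal ij).
Qed.

Definition lift_poly (R : realType) s n b : {poly R[i]} :=
  map_poly intr (twisted_poly s n b).

Lemma lift_poly_inj (R : realType) s n : injective (lift_poly R s n).
Proof.
move=> b c; move/(map_inj_poly (@intr_inj _) (rmorph0 _)) => bc.
apply/ffunP => i; have ni : (i < n)%N by have := ltn_ord i; lia.
have ii : i = minn i (n.-1 - i) :> nat by have := double_ord n i; lia.
have := congr1 (fun p : {poly int} => p`_i) bc.
rewrite /= !(twisted_poly_coef _ _ _ i i ni ii) => /mulfI.
by rewrite signr_eq0 => /(_ isT); case: (b i); case: (c i).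
Qed.

Lemma lift_poly_coef R s n b j :
  (lift_poly R s n b)`_j = ((twisted_poly s n b)`_j)%:~R.
Proof. by rewrite coef_map. Qed.

Lemma size_lift_poly R s n b : (size (lift_poly R s n b) <= n)%N.
Proof.
apply: (leq_trans (size_poly _ _)); apply/leq_sizeP => j nj.
by rewrite coef_comp_scaleX nth_default ?mulr0 // (leq_trans (size_signed_poly n b)).
Qed.

(** For even [n], [j] and [n.-1 - j] have opposite parity, so the twist turns the symmetry into an
    antisymmetry. *)
Lemma twisted_poly_sym (s : bool) n b j : (s -> ~~ odd n) -> (j < n)%N ->
  (twisted_poly s n b)`_j = (-1) ^+ s * (twisted_poly s n b)`_(n.-1 - j).
Proof.
move=> sn jn; have [i ij] := fold_ord n j jn.
rewrite (twisted_poly_coef _ _ _ i j jn ij).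
rewrite (twisted_poly_coef _ _ _ i (n.-1 - j)); try lia.
rewrite mulrA; congr (_ * _); rewrite -signr_addb; congr ((-1) ^+ _).
by case: s sn => //= /(_ isT) sn; lia.
Qed.

Definition symmetric_littlewood (R : realType) (s : bool) n : set {poly R[i]} :=
  [set f | littlewood R n f /\
     forall z : R[i], z != 0 -> f.[z] = (-1) ^+ s * (z ^+ n.-1 * f.[z^-1])].

Lemma symmetric_littlewoodE (R : realType) (s : bool) n : (s -> ~~ odd n) ->
  symmetric_littlewood R s n = range (lift_poly R s n).
Proof.
move=> sn; apply/seteqP; split=> [f [[a [a1 fE]] fsym]|_ [b _ <-]].
  have sf : (size f <= n)%N by rewrite fE size_poly.
  have /(reciprocal_coefP _ _ _ _ sf) fc := fsym.
  have fa j : (j < n)%N -> f`_j = a j by move=> jn; rewrite fE coef_poly jn.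
  have fN j : (j < n)%N -> f`_j = (-1) ^+ (f`_j == -1).
    move=> jn; rewrite fa //; case: (a1 j jn) => ->; last by rewrite eqxx.
    by rewrite -addr_eq0 (_ : 1 + 1 = 2) // pnatr_eq0.
  (* The bits are read off the lower half of the coefficients, with the twist undone. *)
  exists [ffun i : 'I_(uphalf n) => (s && odd i) (+) (f`_i == -1)] => //.
  apply/polyP => j; rewrite lift_poly_coef.
  case: (ltnP j n) => [jn|nj]; last first.
    rewrite [RHS]nth_default ?(leq_trans sf) // -lift_poly_coef nth_default //.
    exact: leq_trans (size_lift_poly _ _ _ _) nj.
  have [i ij] := fold_ord n j jn.
  rewrite (twisted_poly_coef _ _ _ i j jn ij) ffunE -signr_addb rmorph_sign.
  have ni : (i < n)%N by lia.
  (* Either [j] represents its own orbit, or its coefficient is recovered from the mirror image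
     through [fc]. *)
  have [ij'|ij'] : i = j :> nat \/ i = (n.-1 - j)%N :> nat by lia.
    by rewrite ij' addbA addbb addFb -fN.
  rewrite (fc j jn) -ij' [in RHS](fN i ni) -signr_addb; congr ((-1) ^+ _).
  rewrite addbA; congr (_ (+) _).
  by case: s sn {fsym fc} => //= /(_ isT) sn; lia.
split; last first.
  apply/(reciprocal_coefP _ _ _ _ (size_lift_poly _ _ _ _)) => j jn.
  by rewrite !lift_poly_coef (twisted_poly_sym s n b j sn jn) rmorphM rmorph_sign.
exists (fun j => (lift_poly R s n b)`_j); split=> [j jn|].
  have [i ij] := fold_ord n j jn.
  rewrite lift_poly_coef (twisted_poly_coef _ _ _ i j jn ij) -signr_addb rmorph_sign.
  by case: (_ (+) _); [right|left].
apply/polyP => j; rewrite coef_poly; case: ltnP => // nj.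
by rewrite nth_default // (leq_trans (size_lift_poly _ _ _ _)).
Qed.

Lemma circle_norm_lift_poly (R : realType) (s : bool) n b : (s -> ~~ odd n) ->
  circle_norm (4 : R) (lift_poly R s n b) ^+ 4 = (quartic_norm n b)%:~R.
Proof.
move=> sn; rewrite (@circle_norm_quartic R n.-1 ((-1) ^+ s)) ?twisted_poly_quartic //.
  by rewrite sqrr_sign.
have : symmetric_littlewood R s n (lift_poly R s n b).
  by rewrite symmetric_littlewoodE //; exists b.
by case.
Qed.

(** * Moments of uniform draws *)

(** [g (F w)] is a finite combination of indicators of the fibres of [F] over the points [phi i],
    which all have the same probability. *)
Lemma expectation_uniform {d : measure_display} {T : measurableType d}
    {R : realType} (P : probability T R) {U : choiceType} (A : set U) (F : T -> U)
    (I : finType) (phi : I -> U) (g : U -> R) :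
  injective phi -> A = range phi -> drawn_uniformly P A F ->
  ('E_P[fun w => g (F w)])%E = (#|I|%:R^-1 * \sum_i g (phi i))%:E.
Proof.
move=> phiI AE [_ FA Funif].
set c : R := (#|` fset_set A|%fset%:R)^-1 in Funif.
have Aphi i : A (phi i) by rewrite AE; exists i.
have mF i : measurable (F @^-1` [set phi i]) by have [] := Funif _ (Aphi i).
have PF i : P (F @^-1` [set phi i]) = c%:E by have [] := Funif _ (Aphi i).
have sumE (h : U -> R) : ('E_P[fun w => h (F w)])%E = (c * \sum_i h (phi i))%:E.
  rewrite unlock.
  rewrite (eq_integral (fun w => \sum_(i <- index_enum I)
      ((h (phi i))%:E * (\1_(F @^-1` [set phi i]) w)%:E))%E); last first.
    move=> w _; have := FA w; rewrite AE => -[i _ iw].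
    rewrite (bigD1 i) //= indicE mem_set //= mule1 big1 ?adde0 ?iw // => j ji.
    rewrite indicE memNset ?mule0 //= -iw => /phiI ij.
    by rewrite ij eqxx in ji.
  have iF i : P.-integrable setT (fun w => (\1_(F @^-1` [set phi i]) w)%:E : \bar R).
    exact: integrable_indic.
  rewrite integral_sum //=; last by move=> i; apply: integrableZl.
  rewrite mulr_sumr -sumEFin; apply: eq_bigr => i _.
  rewrite integralZl // integral_indic // setIT.
  transitivity ((h (phi i))%:E * c%:E)%E; last by rewrite -EFinM mulrC.
  by congr (_ * _)%E; exact: PF.
(* Taking the constant function 1 in [sumE] determines the common probability without computing the
   cardinality of [A]. *)
suff <- : c = #|I|%:R^-1 by exact: sumE.
have := sumE (fun=> 1); rewrite expectation_cst sumr_const => -[/esym cI].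
have I0 : #|I|%:R != 0 :> R.
  by apply/eqP => I0; move/eqP: cI; rewrite I0 mulr0 eq_sym oner_eq0.
by apply: (mulIf I0); rewrite cI mulVf.
Qed.

Lemma variance_uniform {d : measure_display} {T : measurableType d}
    {R : realType} (P : probability T R) {U : choiceType} (A : set U) (F : T -> U)
    (I : finType) (phi : I -> U) (g : U -> R) (mu : R) :
  injective phi -> A = range phi -> drawn_uniformly P A F ->
  ('E_P[fun w => g (F w)])%E = mu%:E ->
  ('V_P[fun w => g (F w)])%E = (#|I|%:R^-1 * \sum_i (g (phi i) - mu) ^+ 2)%:E.
Proof.
move=> phiI AE Funif muE; rewrite /variance unlock muE /=.
rewrite -(expectation_uniform P A F I phi (fun u => (g u - mu) ^+ 2) phiI AE Funif).
by congr expectation; apply/funext => w; rewrite expr2.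
Qed.

Theorem theorem3 (R : realType) (n : nat) (A : set {poly R[i]})
    (d : measure_display) (T : measurableType d) (P : probability T R)
    (f : T -> {poly R[i]}) :
  (1 < n)%N ->
  A = reciprocal_littlewood R n \/
    (~~ odd n /\ A = neg_reciprocal_littlewood R n) ->
  drawn_uniformly P A f ->
  let X : T -> R := fun w => circle_norm 4 (f w) ^+ 4 in
  ('E_P[X])%E = (3 * n%:R ^+ 2 - 3 * n%:R + (1 - (-1) ^+ n) / 2)%:E /\
  ('V_P[X])%E =
    (if ~~ odd n then
       32 * n%:R ^+ 3 - 216 * n%:R ^+ 2 + 304 * n%:R
         + 256 * (n %/ 6)%N%:R + 256 * (n %% 6 == 4)%N%:R
     else
       32 * n%:R ^+ 3 - 144 * n%:R ^+ 2 + 160 * n%:R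
         - 576 * ((n - 1) %/ 4)%N%:R - 512 * ((n - 1) %/ 6)%N%:R - 48)%:E.
Proof.
move=> n1 AE unifA X.
(* Both classes are treated at once through the sign [(-1) ^+ s]. *)
have [s [sn AsE]] : exists s : bool, (s -> ~~ odd n) /\ A = symmetric_littlewood R s n.
  case: AE => [->|[no ->]]; [exists false|exists true]; split=> //;
    apply/seteqP; split=> g.
  - by move=> [lg H]; split=> // z /H; rewrite mul1r.
  - by move=> [lg H]; split=> // z /H; rewrite mul1r.
  - by move=> [lg _ H]; split=> // z /H; rewrite mulN1r.
  - by move=> [lg H]; split=> // z /H; rewrite mulN1r.
rewrite symmetric_littlewoodE // in AsE.
have phiI := @lift_poly_inj R s n.
pose N : R := 2 ^+ uphalf n.
have cN : #|{ffun 'I_(uphalf n) -> bool}|%:R = N.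
  by rewrite card_ffun card_bool card_ord natrX.
have N0 : N != 0 by rewrite expf_eq0 pnatr_eq0 andbF.
have gE b : circle_norm (4 : R) (lift_poly R s n b) ^+ 4 = (quartic_norm n b)%:~R.
  exact: circle_norm_lift_poly.
have EX : ('E_P[X])%E = ((quartic_mean n)%:~R)%:E.
  rewrite (expectation_uniform P A f _ _ (fun u => circle_norm 4 u ^+ 4) phiI AsE unifA).
  rewrite (eq_bigr _ (fun b _ => gE b)) -rmorph_sum /= sum_quartic_norm; last exact: ltnW.
  by rewrite cN rmorphM rmorphXn /= mulrA mulVf ?mul1r.
split.
  rewrite EX /quartic_mean !(rmorphD, rmorphN, rmorphM, rmorphXn) /= !rmorph_nat.
  congr (_ + _)%:E; rewrite -signr_odd; case: odd => /=.
    by rewrite expr1 opprK -[1 + 1]/2 divff // pnatr_eq0.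
  by rewrite expr0 subrr mul0r.
rewrite (variance_uniform P A f _ _ (fun u => circle_norm 4 u ^+ 4) _ phiI AsE unifA EX).
under eq_bigr do rewrite gE -rmorphB -rmorphXn.
rewrite -rmorph_sum /= sum_quartic_norm_dev //.
rewrite cN rmorphM rmorphXn /= mulrA mulVf ?mul1r // /quartic_variance.
by case: ifP => _; congr EFin; ring.
Qed.
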